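(* Let $$\bar\kappa:=\inf_{\|a\|_2=1}\ \int_0^1\mathbb{E}\Bigl|\sum_{j}a_jB_j(q)\Bigr|\,dq,$$ where the infimum is over all $k\ge1$ and all vectors $a=(a_1,\dots,a_k)\in\mathbb{R}^k$ with $\|a\|_2=1$, and where, for each $q\in[0,1]$, $B_1(q),\dots,B_k(q)$ are independent Bernoulli($q$) random variables. Then $\bar\kappa=\dfrac{\sqrt2}{6}$.
   Context: A Bernoulli($q$) random variable takes the value $1$ with probability $q$ and $0$ with probability $1-q$. *)

(* Defs.v *)
From mathcomp Require Import all_boot all_order all_algebra.
From mathcomp Require Import all_classical all_reals all_analysis.

Set Implicit Arguments.
Unset Strict Implicit.
Unset Printing Implicit Defensive.

Import Order.TTheory GRing.Theory Num.Theory.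

Local Open Scope classical_set_scope.
Local Open Scope ring_scope.

Definition l2norm (R : realType) (k : nat) (a : 'rV[R]_k) : R :=
  Num.sqrt (\sum_(j < k) a 0 j ^+ 2).

Definition bernoulli_RV (d : measure_display) (T : measurableType d)
    (R : realType) (P : probability T R) (q : R) (X : {RV P >-> R}) : Prop :=
  P (X @^-1` [set 1]) = q%:E /\ P (X @^-1` [set 0]) = (1 - q)%:E.

(* Mutual independence: the product rule over every subfamily. *)
Definition independent_RVs (d : measure_display) (T : measurableType d)
    (R : realType) (P : probability T R) (I : finType)
    (X : I -> {RV P >-> R}) : Prop :=
  forall (J : {set I}) (A : I -> set R),
    (forall j, j \in J -> measurable (A j)) ->
    P (\bigcap_(j in [set` J]) X j @^-1` A j) =
    (\prod_(j in J) P (X j @^-1` A j))%E.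

(* The vector [B k q] lives on its own probability space [P k q]; when its    *)
(* entries are independent Bernoulli(q) for q in [0, 1], the value below does  *)
(* not depend on the choice of [P] and [B], since only their law matters.      *)
Definition kappa_bar (R : realType) (d : nat -> R -> measure_display)
    (T : forall (k : nat) (q : R), measurableType (d k q))
    (P : forall (k : nat) (q : R), probability (T k q) R)
    (B : forall (k : nat) (q : R), 'I_k -> {RV (P k q) >-> R}) : \bar R :=
  ereal_inf [set x | exists (k : nat) (a : 'rV[R]_k),
    [/\ (1 <= k)%N, l2norm a = 1 &
        x = (\int[lebesgue_measure]_(q in `[0%R, 1%R])
               'E_(P k q)[fun w => `|\sum_(j < k) a 0%R j * B k q j w|%R])%E]].

(* Main.v *)
Require Import Defs.
From mathcomp Require Import all_boot all_order all_algebra.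
From mathcomp Require Import ring lra zify.

(** Write X(q) for the sum of the a_j B_j(q).  Replacing every B_j by 1 - B_j
    exchanges the laws at q and at 1 - q and turns X into s - X, where s is the
    sum of the a_j; hence E|X(q)| + E|X(1-q)| >= H(q), where H(q) = E|g(q)| and
    g(q) = sum_j a_j (2 B_j(q) - 1).  It therefore suffices to show that the
    integral of H over [0, 1] is at least (sqrt 2 / 3) |a|.

    Couple all parameters through B_j(q) = [U_j <= q] with independent uniform
    U_j, and let Phi be the integral of |g(q)| over q, a random variable with
    mean the integral of H.  Then (E Phi)^2 = E Phi^2 - Var Phi.

    - E Phi^2 is a double integral of E|g(q)||g(q')| >= E g(q) g(q').  The
      covariance of B_j(q) and B_j(q') is k(q,q') = min(q,q') (1 - max(q,q')),
      whose double integral is 1/12, so E Phi^2 >= 4 |a|^2 / 12 = |a|^2 / 3.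

    - Expand F = |g| at each q in the products chi_A of the centred variables
      B_j - q, j in A.  Different sets A are uncorrelated, also across q, so
      with coefficients c_A(q) the variance of Phi is the sum over nonempty A
      of the forms given by the kernel k^|A| evaluated at c_A.  Each is at most
      |A|/6 times the integral of (q(1-q))^|A| c_A(q)^2: for |A| >= 2 by the
      Schur test with a constant weight, and for |A| = 1 because F is even, so
      that c_A is odd about q = 1/2 and the Schur test applies with the weight
      1 - 2q, which attains the constant 1/6.  Summed over A, the right-hand sides are 1/6 of
      the energy of F, a sum over j of squared increments when B_j is resampled.
      The absolute value contracts increments, so this is at most the energy of
      g itself, and Var Phi <= (1/6) 4 |a|^2 (integral of q(1-q)) = |a|^2 / 9.

    The difference is 2 |a|^2 / 9, as required.  Equality holds throughout for
    a = (1, -1) / sqrt 2, where E|X(q)| = sqrt 2 q (1 - q).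

    To keep the algebra finite, q runs over the interior points of a uniform
    grid with n cells, which perturbs the constants by O(1/n)
    ([grid_inequality]).  The laws of two nested cubes enter only through
    [coupling_expansion]; no uniform variables are constructed.  As E|X(q)| is
    a polynomial in q, the passage to the integral ([primitive_absdot_ge]) is an
    elementary estimate on power sums. *)

Set Implicit Arguments.
Unset Strict Implicit.
Unset Printing Implicit Defensive.

Import Order.TTheory GRing.Theory Num.Theory.

Local Open Scope ring_scope.

(** * Fourier analysis on the biased cube *)

Section Cube.
Context {R : realFieldType} {I : finType}.
Implicit Types (q : R) (x y : {ffun I -> bool}) (A : {set I}).
Implicit Types (F G : {ffun I -> bool} -> R) (kap : I -> R).

Definition bern (q : R) (b : bool) : R := if b then q else 1 - q.
Definition dev (q : R) (b : bool) : R := b%:R - q.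
Definition wt (q : R) (x : {ffun I -> bool}) : R := \prod_i bern q (x i).
Definition expct (q : R) (F : {ffun I -> bool} -> R) : R := \sum_x wt q x * F x.
Definition chi (q : R) (A : {set I}) (x : {ffun I -> bool}) : R :=
  \prod_(i in A) dev q (x i).
Definition fhat (q : R) (F : {ffun I -> bool} -> R) (A : {set I}) : R :=
  expct q (fun x => F x * chi q A x).

(** A measure on pairs of points of the cube that is a product over the
    coordinates.  Each coordinate has marginals Bernoulli(q) and Bernoulli(q'),
    and [kap i] is the covariance in coordinate i divided by the product
    q (1 - q) q' (1 - q') of the two variances. *)
Definition coupling (kap : I -> R) (q q' : R) (x y : {ffun I -> bool}) : R :=
  \prod_i (bern q (x i) * bern q' (y i) *
           (1 + kap i * (dev q (x i) * dev q' (y i)))).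

Lemma expct_prod q (phi : I -> bool -> R) :
  expct q (fun x => \prod_i phi i (x i)) =
  \prod_i (q * phi i true + (1 - q) * phi i false).
Proof.
rewrite /expct /wt.
transitivity (\prod_i \sum_(b : bool) (bern q b * phi i b)).
  by rewrite bigA_distr_bigA; apply: eq_bigr => x _; rewrite -big_split.
by apply: eq_bigr => i _; rewrite big_bool.
Qed.

Lemma sum_wt q : \sum_(x : {ffun I -> bool}) wt q x = 1.
Proof.
rewrite /wt -(bigA_distr_bigA (fun _ : I => bern q)) big1 // => i _.
by rewrite big_bool /bern /=; ring.
Qed.

(** Multiplying out the factors 1 + kap i * dev * dev indexes the terms by sets
    A, and the term of A splits into a function of x times one of y.  Parseval's
    identity, the correlation of F at two nested parameters and the effect of
    resampling one coordinate are all instances, for different [kap]. *)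
Lemma coupling_expansion kap q q' F G :
  \sum_x \sum_y coupling kap q q' x y * (F x * G y) =
  \sum_(A : {set I}) (\prod_(i in A) kap i) * (fhat q F A * fhat q' G A).
Proof.
have E x y : coupling kap q q' x y =
    \sum_(A : {set I}) (\prod_(i in A) kap i) * (wt q x * chi q A x * (wt q' y * chi q' A y)).
  rewrite /coupling big_split /=.
  under [X in _ * X]eq_bigr do rewrite addrC.
  rewrite bigA_distr mulr_sumr; apply: eq_bigr => A _.
  rewrite -big_mkcond /= !big_split /= /wt /chi; ring.
under eq_bigr => x _.
  under eq_bigr do rewrite E mulr_suml.
  rewrite exchange_big; over.
rewrite exchange_big; apply: eq_bigr => A _ /=.
rewrite /fhat /expct mulr_suml mulr_sumr; apply: eq_bigr => x _.
rewrite !mulr_sumr; apply: eq_bigr => y _; ring.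
Qed.

Lemma sum_coupling_r kap q q' x : \sum_y coupling kap q q' x y = wt q x.
Proof.
rewrite /coupling /wt.
transitivity (\prod_i \sum_(b : bool) (bern q (x i) * bern q' b *
           (1 + kap i * (dev q (x i) * dev q' b)))).
  by rewrite bigA_distr_bigA.
by apply: eq_bigr => i _; rewrite big_bool /bern /dev /=; ring.
Qed.

Lemma couplingC kap q q' x y : coupling kap q q' x y = coupling kap q' q y x.
Proof. by apply: eq_bigr => i _; ring. Qed.

Lemma chi0 q x : chi q set0 x = 1. Proof. by rewrite /chi big_set0. Qed.

Lemma fhat0 q F : fhat q F set0 = expct q F.
Proof. by apply: eq_bigr => x _; rewrite chi0 mulr1. Qed.

Definition negx (x : {ffun I -> bool}) : {ffun I -> bool} := [ffun i => ~~ x i].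

Lemma negxK : involutive negx.
Proof. by move=> x; apply/ffunP => i; rewrite !ffunE negbK. Qed.

Lemma wt_negx q x : wt q (negx x) = wt (1 - q) x.
Proof. by apply: eq_bigr => i _; rewrite ffunE /bern; case: (x i) => //=; ring. Qed.

Lemma expct_negx q F : expct (1 - q) F = expct q (fun x => F (negx x)).
Proof.
rewrite /expct (reindex_inj (inv_inj negxK)); apply: eq_bigr => x _.
by rewrite wt_negx; congr (wt _ _ * _); ring.
Qed.

(** This oddness about q = 1/2 is the only way in which the evenness of |g| is
    used. *)
Lemma fhat1_even q F i : (forall x, F (negx x) = F x) ->
  fhat (1 - q) F [set i] = - fhat q F [set i].
Proof.
move=> ev; rewrite /fhat expct_negx /expct -sumrN; apply: eq_bigr => x _.
rewrite ev /chi !big_set1 ffunE /dev.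
by case: (x i) => /=; ring.
Qed.

End Cube.

(** * The covariance kernel on a uniform grid *)

Section Kernel.
Context {R : realFieldType}.
Implicit Types q : R.
Definition bvar (q : R) : R := q * (1 - q).

(** The covariance of [U <= q] and [U <= q'] for a uniform U, that is, the
    covariance function of the Brownian bridge. *)
Definition bridge (q q' : R) : R := Num.min q q' * (1 - Num.max q q').

Lemma bridgeC q q' : bridge q q' = bridge q' q.
Proof. by rewrite /bridge minC maxC. Qed.
Lemma bridgeNN q q' : bridge (1 - q) (1 - q') = bridge q q'.
Proof. by rewrite /bridge; case: (leP q q'); case: (leP (1 - q) (1 - q')); nra. Qed.
Lemma bridge_ge0 q q' : 0 <= q <= 1 -> 0 <= q' <= 1 -> 0 <= bridge q q'.
Proof. by rewrite /bridge; case: (leP q q'); nra. Qed.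
Lemma bridge_le_bvar q q' : 0 <= q <= 1 -> 0 <= q' <= 1 -> bridge q q' <= bvar q.
Proof. by rewrite /bridge /bvar; case: (leP q q'); nra. Qed.
Lemma bvar_gt0 q : 0 < q < 1 -> 0 < bvar q.
Proof. by rewrite /bvar => ?; rewrite mulr_gt0; lra. Qed.
End Kernel.

Section Grid.
Context {R : realFieldType} (m : nat).

(** Only interior points, so that all variances are positive; reversal of the
    index is the reflection of q into 1 - q. *)
Definition grid (i : 'I_m) : R := i.+1%:R / m.+1%:R.
Local Notation n := (m.+1%:R : R).

Lemma ncells_gt0 : 0 < n. Proof. by rewrite ltr0n. Qed.

Lemma grid_itv i : 0 < grid i < 1.
Proof.
rewrite /grid divr_gt0 ?ltr0n //= ltr_pdivrMr ?ltr0n // mul1r ltr_nat ltnS.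
exact: ltn_ord.
Qed.

Lemma grid_rev i : grid (rev_ord i) = 1 - grid i.
Proof.
have n0 := ncells_gt0; rewrite /grid /= -natr1 natrB ?ltn_ord //.
have -> : m%:R = n - 1 by rewrite -natr1 addrK.
by move: i.+1%:R n n0 => b N N0; field; lra.
Qed.

Lemma bridge_grid i l : bridge (grid i) (grid l) =
  if (l <= i)%N then (l.+1%:R * (n - i.+1%:R)) / n ^+ 2
  else (i.+1%:R * (n - l.+1%:R)) / n ^+ 2.
Proof.
have n0 := ncells_gt0.
have le a b : (grid a <= grid b) = (a <= b)%N.
  by rewrite /grid ler_pM2r ?invr_gt0 // ler_nat ltnS.
rewrite /bridge; case: leqP => h.
  rewrite min_r ?max_l ?le // /grid.
  by move: i.+1%:R l.+1%:R n n0 => b a N N0; field; lra.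
have hil := ltnW h; rewrite min_l ?max_r ?le // /grid.
by move: i.+1%:R l.+1%:R n n0 => b a N N0; field; lra.
Qed.

(** The kernel is given by different polynomials on either side of the diagonal,
    so sums of its powers are computed by telescoping on each side, with a
    discrete antiderivative for each. *)
Lemma sum_two_sided (i : 'I_m) (g : 'I_m -> R) (P1 P2 : R -> R) :
  (forall l : 'I_m, (l <= i)%N -> g l = P1 l.+1%:R - P1 l%:R) ->
  (forall l : 'I_m, (i < l)%N -> g l = P2 l.+1%:R - P2 l%:R) ->
  \sum_l g l = P1 i.+1%:R - P1 0 + (P2 m%:R - P2 i.+1%:R).
Proof.
move=> h1 h2.
pose f l : R := if (l <= i)%N then P1 l.+1%:R - P1 l%:R
                else P2 l.+1%:R - P2 l%:R.
have -> : \sum_l g l = \sum_(0 <= l < m) f l.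
  rewrite big_mkord; apply: eq_bigr => l _; rewrite /f.
  by case: leqP => h; [exact: h1 | exact: h2].
rewrite (@big_cat_nat _ _ _ i.+1) //=.
rewrite (@telescope_sumr_eq _ 0 i.+1 (fun l => P1 l%:R)) //; last first.
  by move=> l /andP[_ hl]; rewrite /f ifT // -ltnS.
rewrite (@telescope_sumr_eq _ i.+1 m (fun l => P2 l%:R)) //.
by move=> l /andP[hl _]; rewrite /f ifF // leqNgt hl.
Qed.

(** Sums of the first x integers and of their squares, as functions of a real x,
    which serve as discrete antiderivatives. *)
Let s1 (x : R) : R := x * (x + 1) / 2.
Let s2 (x : R) : R := x * (x + 1) * (2 * x + 1) / 6.

Lemma sum_bridge i : \sum_l bridge (grid i) (grid l) = n / 2 * bvar (grid i).
Proof.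
have n0 := ncells_gt0; set b : R := i.+1%:R.
rewrite (@sum_two_sided i _ (fun x => (n - b) / n ^+ 2 * s1 x)
  (fun x => - (b / n ^+ 2 * s1 (n - x - 1)))); first last.
- move=> l h; rewrite bridge_grid leqNgt h /= /s1 -/b -[l.+1%:R]natr1.
  by move: (l%:R) b n n0 => a b' N N0; field; lra.
- move=> l h; rewrite bridge_grid h /= /s1 -/b -[l.+1%:R]natr1.
  by move: (l%:R) b n n0 => a b' N N0; field; lra.
- rewrite /bvar /grid -/b /s1.
  have -> : m%:R = n - 1 by rewrite -natr1 addrK.
  by move: b n n0 => b' N N0; field; lra.
Qed.

(** The kernel is the Green function of the second difference, and the second
    difference of the cubic q (1 - q) (1 - 2q) / 6 equals its second derivative
    2q - 1; hence there is no discretization error. *)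
Lemma sum_bridge_skew i :
  \sum_l bridge (grid i) (grid l) * (1 - 2 * grid l) =
  n / 6 * (bvar (grid i) * (1 - 2 * grid i)).
Proof.
have n0 := ncells_gt0; set b : R := i.+1%:R.
rewrite (@sum_two_sided i _
  (fun x => (n - b) / n ^+ 2 * (s1 x - 2 / n * s2 x))
  (fun x => b / n ^+ 2 * (s1 (n - x - 1) - 2 / n * s2 (n - x - 1)))); first last.
- move=> l h; rewrite bridge_grid leqNgt h /= /s1 /s2 -/b /grid -[l.+1%:R]natr1.
  by move: (l%:R) b n n0 => a b' N N0; field; lra.
- move=> l h; rewrite bridge_grid h /= /s1 /s2 -/b /grid -[l.+1%:R]natr1.
  by move: (l%:R) b n n0 => a b' N N0; field; lra.
- rewrite /bvar /grid -/b /s1 /s2.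
  have -> : m%:R = n - 1 by rewrite -natr1 addrK.
  by move: b n n0 => b' N N0; field; lra.
Qed.

Lemma sum_bridge_sq i : \sum_l bridge (grid i) (grid l) ^+ 2 =
  n / 3 * bvar (grid i) ^+ 2 + bvar (grid i) / (6 * n).
Proof.
have n0 := ncells_gt0; set b : R := i.+1%:R.
rewrite (@sum_two_sided i _ (fun x => (n - b) ^+ 2 / n ^+ 4 * s2 x)
  (fun x => - (b ^+ 2 / n ^+ 4 * s2 (n - x - 1)))); first last.
- move=> l h; rewrite bridge_grid leqNgt h /= /s2 -/b -[l.+1%:R]natr1.
  by move: (l%:R) b n n0 => a b' N N0; field; lra.
- move=> l h; rewrite bridge_grid h /= /s2 -/b -[l.+1%:R]natr1.
  by move: (l%:R) b n n0 => a b' N N0; field; lra.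
- rewrite /bvar /grid -/b /s2.
  have -> : m%:R = n - 1 by rewrite -natr1 addrK.
  by move: b n n0 => b' N N0; field; lra.
Qed.

(** The exact value is n v^2 / 3 + v / (6n); the remainder is absorbed in v^2
    because v >= (n - 1) / n^2 at an interior point. *)
Lemma sum_bridge_sq_le i : \sum_l bridge (grid i) (grid l) ^+ 2 <=
  (n / 3 + 1) * bvar (grid i) ^+ 2.
Proof.
have n0 := ncells_gt0; rewrite sum_bridge_sq [leRHS]mulrDl mul1r lerD2l.
have v0 := bvar_gt0 (grid_itv i).
rewrite expr2 mulrC ler_pM2r // -[_^-1]mul1r ler_pdivrMr ?mulr_gt0 //.
have : 1 <= i.+1%:R :> R by rewrite ler1n.
have : i.+1%:R + 1 <= n by rewrite natr1 ler_nat ltnS ltn_ord.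
rewrite /bvar /grid; move: i.+1%:R => b h1 h2.
have -> : b / n * (1 - b / n) * (6 * n) = 6 * (b * (n - b)) / n by field; lra.
by rewrite ler_pdivlMr //; nra.
Qed.

Lemma sum_bvar : \sum_l bvar (grid l) = (n ^+ 2 - 1) / (6 * n).
Proof.
have n0 := ncells_gt0.
have -> : \sum_l bvar (grid l) = \sum_(0 <= l < m) (l.+1%:R / n * (1 - l.+1%:R / n)).
  by rewrite big_mkord.
rewrite (@telescope_sumr_eq _ 0 m (fun l => s1 l%:R / n - s2 l%:R / n ^+ 2)) //.
  have -> : m%:R = n - 1 by rewrite -natr1 addrK.
  by rewrite /s1 /s2; move: n n0 => N N0; field; lra.
by move=> l _; rewrite /s1 /s2 -[l.+1%:R]natr1; move: (l%:R) n n0 => a N N0; field; lra.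
Qed.

Lemma sum_rev (g : 'I_m -> R) : \sum_l g (rev_ord l) = \sum_l g l.
Proof. by rewrite [RHS](reindex_inj rev_ord_inj). Qed.

(** Schur's test with a constant weight: c_i c_l <= (c_i^2 + c_l^2) / 2. *)
Lemma schur_le (K : 'I_m -> 'I_m -> R) (c M : 'I_m -> R) :
  (forall i l, 0 <= K i l) -> (forall i l, K i l = K l i) ->
  (forall i, \sum_l K i l <= M i) ->
  \sum_i \sum_l K i l * (c i * c l) <= \sum_i M i * c i ^+ 2.
Proof.
move=> K0 KC KM.
have le : \sum_i \sum_l K i l * (c i * c l) <= \sum_i \sum_l K i l * c i ^+ 2.
  have -> : \sum_i \sum_l K i l * c i ^+ 2 =
            \sum_i \sum_l K i l * ((c i ^+ 2 + c l ^+ 2) / 2).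
    have E : \sum_i \sum_l K i l * c l ^+ 2 = \sum_i \sum_l K i l * c i ^+ 2.
      rewrite exchange_big; apply: eq_bigr => i _; apply: eq_bigr => l _.
      by rewrite KC.
    transitivity ((\sum_i \sum_l K i l * c i ^+ 2 +
                   \sum_i \sum_l K i l * c l ^+ 2) / 2).
      by rewrite E; field.
    rewrite -big_split /= mulr_suml; apply: eq_bigr => i _.
    rewrite -big_split /= mulr_suml; apply: eq_bigr => l _; ring.
  apply: ler_sum => i _; apply: ler_sum => l _.
  by apply: ler_wpM2l => //; have := sqr_ge0 (c i - c l); lra.
apply: (le_trans le); apply: ler_sum => i _.
by rewrite -mulr_suml ler_wpM2r ?sqr_ge0.
Qed.

(** Since k(q,q') <= v(q) := q (1 - q), a row sum of k^j is at most v^(j-2)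
    times a row sum of k^2, which is about n v^2 / 3; and 1/3 <= j/6. *)
Lemma bridge_form_ge2 (c : 'I_m -> R) (j : nat) : (2 <= j)%N ->
  \sum_i \sum_l bridge (grid i) (grid l) ^+ j * (c i * c l) <=
  (n / 3 + 1) * \sum_i bvar (grid i) ^+ j * c i ^+ 2.
Proof.
move=> j2; have itv i : 0 <= grid i <= 1 by have := grid_itv i; lra.
have c0 i l : 0 <= bridge (grid i) (grid l) by exact: bridge_ge0.
apply: (@le_trans _ _ (\sum_i (n / 3 + 1) * bvar (grid i) ^+ j * c i ^+ 2)).
  apply: schur_le => [i l|i l|i]; first exact: exprn_ge0.
    by rewrite bridgeC.
  rewrite -(subnKC j2) exprD; under eq_bigr do rewrite exprD.
  apply: (@le_trans _ _ (\sum_l bridge (grid i) (grid l) ^+ 2 * bvar (grid i) ^+ (j - 2))).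
    apply: ler_sum => l _; rewrite ler_wpM2l ?exprn_ge0 //.
    by apply: lerXn2r; rewrite ?nnegrE ?bridge_le_bvar ?c0 // ltW // bvar_gt0 // grid_itv.
  rewrite -mulr_suml mulrA ler_wpM2r ?sum_bridge_sq_le //.
  by rewrite exprn_ge0 // ltW // bvar_gt0 // grid_itv.
by rewrite mulr_sumr; apply: ler_sum => i _; rewrite mulrA.
Qed.

(** On a fixed side of 1/2 the kernel prefers points on the same side.  This
    replaces the positivity of the kernel when the weight 1 - 2q changes sign. *)
Lemma bridge_reflect_sign (q q' : R) : 0 <= q <= 1 -> 0 <= q' <= 1 ->
  0 <= (bridge q q' - bridge q (1 - q')) * ((1 - 2 * q) * (1 - 2 * q')).
Proof.
move=> hq hq'.
have E : forall p p' : R, 0 <= p <= 1 -> 0 <= p' <= 1 -> p <= 1/2 ->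
   0 <= (bridge p p' - bridge p (1 - p')) * (1 - 2 * p').
  move=> p p' hp hp' h; rewrite /bridge.
  case: (leP p p') => h1; case: (leP p (1 - p')) => h2; last by lra.
  - have -> : (p * (1 - p') - p * (1 - (1 - p'))) * (1 - 2 * p') =
              p * (1 - 2 * p') ^+ 2 by ring.
    by rewrite mulr_ge0 ?sqr_ge0 //; lra.
  - have -> : (p * (1 - p') - (1 - p') * (1 - p)) * (1 - 2 * p') =
              (1 - p') * ((1 - 2 * p) * (2 * p' - 1)) by ring.
    by rewrite !mulr_ge0 //; lra.
  - have -> : (p' * (1 - p) - p * (1 - (1 - p'))) * (1 - 2 * p') =
              p' * ((1 - 2 * p) * (1 - 2 * p')) by ring.
    by rewrite !mulr_ge0 //; lra.
case: (leP q (1/2)) => h.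
  by rewrite mulrCA mulr_ge0 ?E //; lra.
have h' : 0 <= 1 - q <= 1 by lra.
have := E (1 - q) q' h' hq'.
have -> : bridge (1 - q) q' = bridge q (1 - q') by rewrite -[in LHS](subKr 1 q') bridgeNN.
rewrite bridgeNN => /(_ ltac:(lra)); nra.
Qed.

(** Without oddness the constant would be n / 2, attained by constant c.  With
    c = w b for w = 1 - 2q and b even, the defect of the inequality is
    the sum of k w w' (b - b')^2 / 2, which is nonnegative after pairing each
    q' with 1 - q'. *)
Lemma bridge_form_odd (c : 'I_m -> R) : (forall i, c (rev_ord i) = - c i) ->
  \sum_i \sum_l bridge (grid i) (grid l) * (c i * c l) <=
  n / 6 * \sum_i bvar (grid i) * c i ^+ 2.
Proof.
move=> odd; pose w i := 1 - 2 * grid i; pose b i := c i / w i.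
have itv i : 0 <= grid i <= 1 by have := grid_itv i; lra.
have wr i : w (rev_ord i) = - w i by rewrite /w grid_rev; ring.
have br i : b (rev_ord i) = b i by rewrite /b wr odd invrN mulrNN.
have cE i : c i = w i * b i.
  rewrite /b; have [w0|w0] := eqVneq (w i) 0; last by field.
  (* w vanishes only at q = 1/2, a fixed point of the reflection, where the odd
     function c vanishes as well; there b is 0 by the convention x / 0 = 0. *)
  have ri : rev_ord i = i.
    apply/val_inj => /=; have := w0; rewrite /w /grid => h.
    have : (2 * i.+1 = m.+1)%N.
      apply/eqP; rewrite -(eqr_nat R) natrM; apply/eqP.
      have n0 := ncells_gt0.
      have : n * (1 - 2 * (i.+1%:R / n)) = 0 by rewrite h mulr0.
      have -> : n * (1 - 2 * (i.+1%:R / n)) = n - 2 * i.+1%:R by field; lra.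
      lra.
    lia.
  by have := odd i; rewrite ri w0; lra.
pose K i l := bridge (grid i) (grid l) * (w i * w l).
have KC i l : K i l = K l i by rewrite /K bridgeC; ring.
have E1 : \sum_i \sum_l K i l * b i ^+ 2 = n / 6 * \sum_i bvar (grid i) * c i ^+ 2.
  rewrite mulr_sumr; apply: eq_bigr => i _.
  transitivity ((\sum_l bridge (grid i) (grid l) * w l) * (w i * b i ^+ 2)).
    by rewrite mulr_suml; apply: eq_bigr => l _; rewrite /K; ring.
  by rewrite sum_bridge_skew cE -/(w i); ring.
have E2 : \sum_i \sum_l K i l * b l ^+ 2 = \sum_i \sum_l K i l * b i ^+ 2.
  rewrite exchange_big; apply: eq_bigr => i _; apply: eq_bigr => l _.
  by rewrite KC.
have E3 : \sum_i \sum_l K i l * (b i - b l) ^+ 2 =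
    2 * \sum_i \sum_l K i l * b i ^+ 2 - 2 * \sum_i \sum_l K i l * (b i * b l).
  transitivity (\sum_i \sum_l K i l * b i ^+ 2 + \sum_i \sum_l K i l * b l ^+ 2 -
     2 * \sum_i \sum_l K i l * (b i * b l)); last by rewrite E2; ring.
  rewrite mulr_sumr -big_split -sumrB; apply: eq_bigr => i _ /=.
  rewrite mulr_sumr -big_split -sumrB; apply: eq_bigr => l _ /=; ring.
have E4 : 0 <= 2 * \sum_i \sum_l K i l * (b i - b l) ^+ 2.
  have -> : 2 * \sum_i \sum_l K i l * (b i - b l) ^+ 2 =
     \sum_i \sum_l K i l * (b i - b l) ^+ 2 +
     \sum_i \sum_l K i (rev_ord l) * (b i - b l) ^+ 2.
    rewrite mulr_natl mulr2n; congr (_ + _); apply: eq_bigr => i _.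
    by rewrite -sum_rev; apply: eq_bigr => l _; rewrite br.
  rewrite -big_split sumr_ge0 // => i _; rewrite -big_split sumr_ge0 // => l _ /=.
  rewrite -mulrDl mulr_ge0 ?sqr_ge0 // /K wr grid_rev.
  by have := bridge_reflect_sign (itv i) (itv l); rewrite -/(w i) -/(w l); lra.
rewrite -E1.
have -> : \sum_i \sum_l bridge (grid i) (grid l) * (c i * c l) =
          \sum_i \sum_l K i l * (b i * b l).
  apply: eq_bigr => i _; apply: eq_bigr => l _.
  by rewrite !cE /K; ring.
lra.
Qed.
End Grid.

(** * Energy of the absolute value of a linear form *)

Section Energy.
Context {R : realFieldType} {I : finType}.
Implicit Types (q : R) (x y : {ffun I -> bool}) (A : {set I}).
Implicit Types (F G : {ffun I -> bool} -> R) (kap : I -> R).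

(** Under the coupling by a common uniform variable the joint law of the two bits
    is min(q,q'), q - min, q' - min and 1 - max, all nonnegative. *)
Lemma nested_bit_ge0 q q' (b c : bool) : 0 < q < 1 -> 0 < q' < 1 ->
  0 <= bern q b * bern q' c *
       (1 + bridge q q' / (bvar q * bvar q') * (dev q b * dev q' c)).
Proof.
move=> hq hq'; have v0 := bvar_gt0 hq; have v0' := bvar_gt0 hq'.
have -> : bern q b * bern q' c *
       (1 + bridge q q' / (bvar q * bvar q') * (dev q b * dev q' c)) =
   bern q b * bern q' c + (if b == c then bridge q q' else - bridge q q').
  move: v0 v0'; rewrite /bern /dev /bvar; case: b; case: c => /= v0 v0';
    field; apply/and4P; split; nra.
rewrite /bridge /bern; case: b; case: c => /=; case: (leP q q') => h; nra.
Qed.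

Lemma nested_coupling_ge0 q q' x y : 0 < q < 1 -> 0 < q' < 1 ->
  0 <= coupling (fun=> bridge q q' / (bvar q * bvar q')) q q' x y.
Proof. by move=> hq hq'; apply: prodr_ge0 => i _; exact: nested_bit_ge0. Qed.

(** Both marginals of the coupling are Bernoulli(q) products, so the squares
    contribute twice the second moment of F. *)
Lemma sum_sq_increment kap q F :
  \sum_x \sum_y coupling kap q q x y * (F x - F y) ^+ 2 =
  2 * (expct q (fun x => F x ^+ 2) -
       \sum_(A : {set I}) (\prod_(i in A) kap i) * fhat q F A ^+ 2).
Proof.
transitivity (expct q (fun x => F x ^+ 2) + expct q (fun x => F x ^+ 2) -
  2 * \sum_x \sum_y coupling kap q q x y * (F x * F y)); last first.
  rewrite coupling_expansion; under eq_bigr do rewrite -expr2; ring.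
have -> : expct q (fun x => F x ^+ 2) =
    \sum_x \sum_y coupling kap q q x y * F x ^+ 2.
  by apply: eq_bigr => x _; rewrite -mulr_suml sum_coupling_r.
have -> : \sum_x \sum_y coupling kap q q x y * F x ^+ 2 +
   \sum_x \sum_y coupling kap q q x y * F x ^+ 2 =
   \sum_x \sum_y coupling kap q q x y * F x ^+ 2 +
   \sum_x \sum_y coupling kap q q x y * F y ^+ 2.
  congr (_ + _); rewrite exchange_big /=.
  by apply: eq_bigr => x _; apply: eq_bigr => y _; rewrite couplingC.
rewrite mulr_sumr -big_split -sumrB; apply: eq_bigr => x _ /=.
rewrite mulr_sumr -big_split -sumrB; apply: eq_bigr => y _ /=; ring.
Qed.

(** The normalized covariance 1 / (q (1 - q)) at q' = q makes the two points
    equal. *)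
Lemma diag_coupling0 q x y : 0 < q < 1 -> x != y ->
  coupling (fun=> (bvar q)^-1) q q x y = 0.
Proof.
move=> hq nxy; have v0 := bvar_gt0 hq.
have [i nxyi] : exists i, x i != y i.
  apply/existsP; apply: contraR nxy; rewrite negb_exists => /forallP h.
  by apply/eqP/ffunP => i; apply/eqP; rewrite -[_ == _]negbK.
rewrite /coupling (bigD1 i) //=.
suff -> : bern q (x i) * bern q (y i) *
   (1 + (bvar q)^-1 * (dev q (x i) * dev q (y i))) = 0 by rewrite mul0r.
move: v0 nxyi; rewrite /bern /dev /bvar.
by case: (x i); case: (y i) => //= v0 _; field; apply/andP; split; nra.
Qed.

(** On the right, coordinate j is drawn afresh and all others are kept.  The
    identity compares this coupling with the diagonal one, whose increments
    vanish: in the expansions they differ exactly in the sets A containing j. *)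
Lemma energy_resample q F j : 0 < q < 1 ->
  \sum_(A : {set I} | j \in A) (bvar q)^-1 ^+ #|A| * fhat q F A ^+ 2 =
  2^-1 * \sum_x \sum_y
    coupling (fun i => if i == j then 0 else (bvar q)^-1) q q x y *
    (F x - F y) ^+ 2.
Proof.
move=> hq.
have D : \sum_x \sum_y coupling (fun=> (bvar q)^-1) q q x y * (F x - F y) ^+ 2 = 0.
  apply: big1 => x _; apply: big1 => y _.
  have [->|nxy] := eqVneq x y; first by rewrite subrr expr0n mulr0.
  by rewrite diag_coupling0 ?mul0r.
rewrite -[RHS]subr0 -[X in _ - X](mulr0 2^-1) -[X in _ - _ * X]D !sum_sq_increment.
rewrite -mulrBr -mulrBr opprB addrC addrA subrK mulrA mulVf ?pnatr_eq0 // mul1r.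
rewrite -sumrB big_mkcond; apply: eq_bigr => A _.
rewrite prodr_const; case: ifP => [jA|/negbT jA].
  by rewrite (bigD1 j) //= eqxx !mul0r subr0.
rewrite (eq_bigr (fun=> (bvar q)^-1)) ?prodr_const ?subrr // => i iA.
by case: eqP => // ij; rewrite ij (negbTE jA) in iA.
Qed.

Context (a : I -> R).
Definition spin (b : bool) : R := 2 * b%:R - 1.
Definition signsum (x : {ffun I -> bool}) : R := \sum_j a j * spin (x j).

Lemma signsum_negx x : signsum (negx x) = - signsum x.
Proof.
rewrite /signsum -sumrN; apply: eq_bigr => j _; rewrite ffunE /spin.
by case: (x j) => /=; ring.
Qed.

Lemma expct_spin_chi q j A :
  expct q (fun x => spin (x j) * chi q A x) =
  if A == set0 then 2 * q - 1 else if A == [set j] then 2 * bvar q else 0.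
Proof.
pose phi i (b : bool) : R :=
  (if i == j then spin b else 1) * (if i \in A then dev q b else 1).
have -> : expct q (fun x => spin (x j) * chi q A x) =
          expct q (fun x => \prod_i phi i (x i)).
  apply: eq_bigr => x _; congr (_ * _); rewrite /phi big_split /=.
  by rewrite -!big_mkcond big_pred1_eq.
rewrite expct_prod.
have [AsubJ|/subsetPn[i iA]] := boolP (A \subset [set j]); last first.
  rewrite inE => ij.
  rewrite (bigD1 i) //= /phi (negbTE ij) iA /dev /=.
  have -> : (A == set0) = false by apply/negP => /eqP A0; rewrite A0 inE in iA.
  have -> : (A == [set j]) = false.
    by apply/negP => /eqP A1; rewrite A1 inE (negbTE ij) in iA.
  ring.
rewrite (bigD1 j) //= big1 => [|i ij]; last first.
  rewrite /phi (negbTE ij).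
  have -> : (i \in A) = false.
    by apply/negP => /(subsetP AsubJ); rewrite inE (negbTE ij).
  ring.
move: AsubJ; rewrite subset1 /phi eqxx => /orP[/eqP->|/eqP->].
  rewrite inE !eqxx -cards_eq0 cards1 /spin /dev /bvar /=; ring.
rewrite !inE !eqxx /spin /=; ring.
Qed.

Lemma fhat_signsum q A : fhat q signsum A =
  \sum_j a j * (if A == set0 then 2 * q - 1
                else if A == [set j] then 2 * bvar q else 0).
Proof.
under [RHS]eq_bigr do rewrite -expct_spin_chi /expct mulr_sumr.
rewrite exchange_big; apply: eq_bigr => x _ /=.
rewrite /signsum mulr_suml mulr_sumr; apply: eq_bigr => j _; ring.
Qed.

Lemma fhat_signsum0 q : fhat q signsum set0 = (2 * q - 1) * \sum_j a j.
Proof. by rewrite fhat_signsum eqxx -mulr_suml mulrC. Qed.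

Lemma fhat_signsum1 q j : fhat q signsum [set j] = 2 * a j * bvar q.
Proof.
rewrite fhat_signsum -cards_eq0 cards1 /= (bigD1 j) //= eqxx big1 ?addr0; first ring.
by move=> i ij; rewrite (inj_eq set1_inj) eq_sym (negbTE ij) mulr0.
Qed.

Lemma fhat_signsum_ge2 q A : A != set0 -> (forall j, A != [set j]) -> fhat q signsum A = 0.
Proof.
move=> A0 A1; rewrite fhat_signsum (negbTE A0) big1 // => j _.
by rewrite (negbTE (A1 j)) mulr0.
Qed.

Definition sqnorm : R := \sum_j a j ^+ 2.

(** The absolute value is a contraction, so its increments under resampling are
    at most those of the linear form, whose only coefficient at a set
    containing j is the one at [set j]. *)
Lemma energy_abs_signsum q j : 0 < q < 1 ->
  \sum_(A : {set I} | j \in A)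
    (bvar q)^-1 ^+ #|A| * fhat q (fun x => `|signsum x|) A ^+ 2 <=
  4 * a j ^+ 2 * bvar q.
Proof.
move=> hq; have v0 := bvar_gt0 hq.
apply: (@le_trans _ _ (\sum_(A : {set I} | j \in A)
    (bvar q)^-1 ^+ #|A| * fhat q signsum A ^+ 2)).
  rewrite !energy_resample // ler_wpM2l ?invr_ge0 //.
  apply: ler_sum => x _; apply: ler_sum => y _; rewrite ler_wpM2l //.
    apply: prodr_ge0 => i _; case: eqP => _.
      by rewrite mul0r addr0 mulr1 mulr_ge0 // /bern; case: ifP => _; lra.
    have := @nested_bit_ge0 q q (x i) (y i) hq hq.
    have -> : bridge q q = bvar q by rewrite /bridge minxx maxxx.
    by have -> : bvar q / (bvar q * bvar q) = (bvar q)^-1 by field; lra.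
  rewrite -[leLHS]real_normK ?num_real // -[leRHS]real_normK ?num_real //.
  by rewrite lerXn2r ?nnegrE // ler_dist_dist.
rewrite (bigD1 [set j]) ?inE ?eqxx //= big1 ?addr0.
  rewrite fhat_signsum1 cards1 expr1 le_eqVlt; apply/orP; left; apply/eqP.
  by field; lra.
move=> A /andP[jA Aj]; rewrite fhat_signsum_ge2 ?expr0n ?mulr0 //.
  by apply/negP => /eqP A0; rewrite A0 inE in jA.
move=> i; apply: contra Aj => /eqP Ai; move: jA.
by rewrite Ai inE => /eqP->.
Qed.

(** The first term is the product of the means; the second one adds up the
    covariances of the coordinates. *)
Lemma coupling_signsum (k q q' : R) :
  \sum_x \sum_y coupling (fun=> k) q q' x y * (signsum x * signsum y) =
  (2 * q - 1) * (2 * q' - 1) * (\sum_j a j) ^+ 2 +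
  4 * k * (bvar q * bvar q') * sqnorm.
Proof.
rewrite coupling_expansion (bigD1 set0) //= big_set0 !fhat_signsum0.
congr (_ + _); first ring.
rewrite /sqnorm mulr_sumr.
transitivity (\sum_(A in [set [set j] | j : I]) k ^+ #|A| * (fhat q signsum A * fhat q' signsum A)).
  rewrite big_mkcond [RHS]big_mkcond; apply: eq_bigr => A _ /=.
  rewrite prodr_const; case: imsetP => [[j _ ->]|nA].
    by rewrite -cards_eq0 cards1.
  case: ifP => // A0; rewrite fhat_signsum_ge2 ?mul0r ?mulr0 // => j.
  by apply/negP => /eqP Aj; apply: nA; exists j.
rewrite big_imset /=; last by move=> i j _ _; exact: set1_inj.
apply: eq_bigr => j _; rewrite cards1 !fhat_signsum1; ring.
Qed.

End Energy.

(** * The inequality on the grid *)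

Section GridInequality.
Context {R : realFieldType} {I : finType} (a : I -> R) (m : nat).
Local Notation n := (m.+1%:R : R).
Local Notation F := (fun x : {ffun I -> bool} => `|signsum a x|).
Local Notation gr := (@grid R m).
Local Notation kap i l := (bridge (gr i) (gr l) / (bvar (gr i) * bvar (gr l))).

(** The contribution of the set A to the variance of the grid sum, against
    #|A| / 6 times its contribution to the energy. *)
Lemma mode_le (A : {set I}) : A != set0 ->
  \sum_i \sum_l kap i l ^+ #|A| * (fhat (gr i) F A * fhat (gr l) F A) <=
  (n / 6 + 1 / 2) * (#|A|%:R *
    \sum_i (bvar (gr i))^-1 ^+ #|A| * fhat (gr i) F A ^+ 2).
Proof.
move=> A0.
have v0 i : 0 < bvar (gr i) := bvar_gt0 (grid_itv i).
pose c i := fhat (gr i) F A / bvar (gr i) ^+ #|A|.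
have E1 : \sum_i \sum_l kap i l ^+ #|A| * (fhat (gr i) F A * fhat (gr l) F A) =
    \sum_i \sum_l bridge (gr i) (gr l) ^+ #|A| * (c i * c l).
  apply: eq_bigr => i _; apply: eq_bigr => l _.
  have := expf_neq0 #|A| (lt0r_neq0 (v0 i)).
  have := expf_neq0 #|A| (lt0r_neq0 (v0 l)).
  rewrite /c expr_div_n (exprMn _ (bvar (gr i))).
  move: (bvar (gr i) ^+ _) (bvar (gr l) ^+ _) (bridge _ _ ^+ _) => vi vl k vl0 vi0.
  by field; rewrite vi0 vl0.
have E2 : \sum_i (bvar (gr i))^-1 ^+ #|A| * fhat (gr i) F A ^+ 2 =
          \sum_i bvar (gr i) ^+ #|A| * c i ^+ 2.
  apply: eq_bigr => i _; rewrite /c exprVn.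
  by field; rewrite expf_neq0 // lt0r_neq0.
rewrite E1 E2.
have S0 : 0 <= \sum_i bvar (gr i) ^+ #|A| * c i ^+ 2.
  by apply: sumr_ge0 => i _; rewrite mulr_ge0 ?sqr_ge0 ?exprn_ge0 // ltW.
have n0 : 0 < n by rewrite ltr0n.
have [A1|A2] := leqP #|A| 1.
  have /cards1P[j Aj] : #|A| == 1%N by rewrite eqn_leq A1 lt0n cards_eq0.
  have odd i : c (rev_ord i) = - c i.
    rewrite /c Aj cards1 grid_rev fhat1_even; last by move=> x; rewrite signsum_negx normrN.
    by rewrite mulNr; congr (- (_ / _)); rewrite /bvar; ring.
  have c1 : #|A| = 1%N by rewrite Aj cards1.
  rewrite c1 in S0 *; rewrite [1%:R * _]mul1r; apply: (le_trans (bridge_form_odd odd)).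
  by apply: ler_wpM2r; [exact: S0 | lra].
apply: (le_trans (bridge_form_ge2 c A2)); rewrite mulrA ler_wpM2r //.
have : 2 <= #|A|%:R :> R by rewrite ler_nat.
nra.
Qed.

(** The square of the summed means is the term A = set0 in the expansion of the
    second moment of the grid sum.  The factor n/3 - 1/2 is n/2, from the second
    moment, minus n/6 + 1/2, from the variance. *)
Theorem grid_inequality :
  4 * sqnorm a * (n / 3 - 1 / 2) * \sum_(i < m) bvar (gr i) <=
  (\sum_(i < m) expct (gr i) F) ^+ 2.
Proof.
pose N i l := \sum_x \sum_y coupling (fun=> kap i l) (gr i) (gr l) x y * (F x * F y).
have v0 i : 0 < bvar (gr i) := bvar_gt0 (grid_itv i).
have low : 4 * sqnorm a * (n / 2) * \sum_i bvar (gr i) <= \sum_i \sum_l N i l.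
  apply: (@le_trans _ _ (\sum_i \sum_l
      ((2 * gr i - 1) * (2 * gr l - 1) * (\sum_j a j) ^+ 2 +
       4 * bridge (gr i) (gr l) * sqnorm a))); last first.
    apply: ler_sum => i _; apply: ler_sum => l _.
    have -> : 4 * bridge (gr i) (gr l) * sqnorm a =
              4 * kap i l * (bvar (gr i) * bvar (gr l)) * sqnorm a.
      by field; rewrite !lt0r_neq0.
    rewrite -coupling_signsum; apply: ler_sum => x _; apply: ler_sum => y _.
    rewrite ler_wpM2l ?nested_coupling_ge0 ?grid_itv //.
    by rewrite -normrM ler_norm.
  have -> : \sum_i \sum_l
      ((2 * gr i - 1) * (2 * gr l - 1) * (\sum_j a j) ^+ 2 +
       4 * bridge (gr i) (gr l) * sqnorm a) =
    (\sum_i (2 * gr i - 1)) ^+ 2 * (\sum_j a j) ^+ 2 +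
    4 * sqnorm a * (n / 2) * \sum_i bvar (gr i).
    under eq_bigr do rewrite big_split /=.
    rewrite big_split /=; congr (_ + _).
      rewrite [_ ^+ 2 in RHS]expr2 big_distrlr /= mulr_suml.
      by apply: eq_bigr => i _; rewrite mulr_suml.
    rewrite mulr_sumr; apply: eq_bigr => i _.
    by rewrite -mulr_suml -mulr_sumr sum_bridge; ring.
  by rewrite lerDr mulr_ge0 ?sqr_ge0.
have up : \sum_i \sum_l N i l <= (\sum_i expct (gr i) F) ^+ 2 +
    (n / 6 + 1 / 2) * (4 * sqnorm a * \sum_i bvar (gr i)).
  have -> : \sum_i \sum_l N i l = \sum_(A : {set I}) \sum_i \sum_l
     kap i l ^+ #|A| * (fhat (gr i) F A * fhat (gr l) F A).
    rewrite [RHS]exchange_big /=; apply: eq_bigr => i _.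
    rewrite [RHS]exchange_big /=; apply: eq_bigr => l _.
    by rewrite /N coupling_expansion; apply: eq_bigr => A _; rewrite prodr_const.
  rewrite (bigD1 set0) //= lerD //.
    rewrite cards0 expr2 mulr_suml ler_sum // => i _.
    by rewrite mulr_sumr ler_sum // => l _; rewrite mul1r !fhat0.
  apply: (@le_trans _ _ ((n / 6 + 1 / 2) * \sum_(A : {set I})
     \sum_(j in A) \sum_i (bvar (gr i))^-1 ^+ #|A| * fhat (gr i) F A ^+ 2)).
    rewrite [X in _ <= _ * X](bigD1 set0) //= big_set0 add0r mulr_sumr.
    apply: ler_sum => A A0; rewrite sumr_const -[(\sum_(_ < _) _) *+ _]mulr_natl; exact: mode_le.
  rewrite ler_wpM2l ?addr_ge0 ?divr_ge0 //.
  rewrite (exchange_big_dep predT) //= /sqnorm mulr_sumr mulr_suml.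
  apply: ler_sum => j _; rewrite exchange_big /= mulr_sumr.
  by apply: ler_sum => i _; apply: energy_abs_signsum; exact: grid_itv.
by have := le_trans low up; lra.
Qed.

End GridInequality.

(** * Riemann sums of polynomials *)

Section Primitive.
Context {R : realFieldType}.
Implicit Types p : {poly R}.

(** The constant coefficient is p`_0 / 0 = 0. *)
Definition primitive (p : {poly R}) : {poly R} :=
  \poly_(i < (size p).+1) (p`_i.-1 / i%:R).

Lemma deriv_primitive p : (primitive p)^`() = p.
Proof.
apply/polyP => i; rewrite coef_deriv coef_poly /= ltnS.
case: ltnP => [_|h]; last by rewrite nth_default // mul0rn.
by rewrite -[_ *+ i.+1]mulr_natr divfK // pnatr_eq0.
Qed.

Lemma primitive_at0 p : (primitive p).[0] = 0.
Proof. by rewrite horner_coef0 coef_poly /= invr0 mulr0. Qed.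

Lemma primitive_at1 p : (primitive p).[1] = \sum_(i < size p) p`_i / i.+1%:R.
Proof.
rewrite (@horner_coef_wide _ (size p).+1) ?size_poly // big_ord_recl /=.
rewrite coef_poly /= invr0 mulr0 mul0r add0r; apply: eq_bigr => i _.
by rewrite expr1n mulr1 coef_poly /= /bump /= ltnS ltn_ord.
Qed.

(** The increments of x^(d+1) over the cells add up to 1, and on each cell the
    increment lies between (d+1)/n times the values of x^d at the end points.
    The error 1/n accounts for the point x = 1, which is not in the grid. *)
Lemma grid_sum_monomial (m d : nat) :
  `|(\sum_(i < m) @grid R m i ^+ d) / m.+1%:R - d.+1%:R^-1| <= m.+1%:R^-1.
Proof.
set n : R := m.+1%:R; set D : R := d.+1%:R.
have n0 : 0 < n by rewrite ltr0n.
have D0 : 0 < D by rewrite ltr0n.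
have ni0 : 0 <= n^-1 by rewrite invr_ge0 ltW.
pose f (l : nat) : R := (l%:R / n) ^+ d.+1.
have f0 (l : nat) : 0 <= l%:R / n by rewrite divr_ge0 // ltW.
have step (l : nat) : l.+1%:R / n - l%:R / n = n^-1.
  by rewrite -mulrBl -natr1 addrAC subrr add0r mul1r.
have tele : \sum_(0 <= l < m.+1) (f l.+1 - f l) = 1.
  by rewrite telescope_sumr // /f mul0r expr0n subr0 divff ?expr1n // gt_eqF.
have sub_pow (l : nat) : f l.+1 - f l =
    n^-1 * \sum_(i < d.+1) (l.+1%:R / n) ^+ (d.+1.-1 - i) * (l%:R / n) ^+ i.
  by rewrite /f subrXX step.
have lele (l : nat) : l%:R / n <= l.+1%:R / n.
  by rewrite ler_wpM2r // ler_nat.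
have cst (x : R) : \sum_(i < d.+1) x = D * x by rewrite sumr_const card_ord mulr_natl.
have hi (l : nat) : f l.+1 - f l <= n^-1 * (D * (l.+1%:R / n) ^+ d).
  rewrite sub_pow ler_wpM2l // -cst; apply: ler_sum => i _ /=.
  have id : (i <= d)%N by rewrite -ltnS.
  have -> : (l.+1%:R / n) ^+ d = (l.+1%:R / n) ^+ (d - i) * (l.+1%:R / n) ^+ i.
    by rewrite -exprD subnK.
  by rewrite ler_wpM2l ?exprn_ge0 // lerXn2r // nnegrE.
have lo (l : nat) : n^-1 * (D * (l%:R / n) ^+ d) <= f l.+1 - f l.
  rewrite sub_pow ler_wpM2l // -cst; apply: ler_sum => i _ /=.
  have id : (i <= d)%N by rewrite -ltnS.
  have -> : (l%:R / n) ^+ d = (l%:R / n) ^+ (d - i) * (l%:R / n) ^+ i.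
    by rewrite -exprD subnK.
  by rewrite ler_wpM2r ?exprn_ge0 // lerXn2r // nnegrE.
set S := \sum_(i < m) _.
have SE : S = \sum_(0 <= l < m) (l.+1%:R / n) ^+ d by rewrite /S big_mkord.
have up : 1 <= n^-1 * (D * (S + 1)).
  rewrite -[leLHS]tele; apply: (le_trans (ler_sum _ (fun l _ => hi l))).
  rewrite -mulr_sumr -mulr_sumr big_nat_recr //= -SE divff ?expr1n //; exact: lt0r_neq0.
have dn : n^-1 * (D * S) <= 1.
  rewrite -[leRHS]tele; apply: le_trans (ler_sum _ (fun l _ => lo l)).
  rewrite -mulr_sumr -mulr_sumr big_nat_recl //= -SE.
  by rewrite ler_wpM2l // ler_wpM2l ?(ltW D0) // lerDr exprn_ge0.
have E : S / n - D^-1 = (n^-1 * (D * S) - 1) / D.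
  by move: (D) (n) D0 n0 => D' n' D0 n0; field; lra.
have E' : n^-1 * (D * (S + 1)) = n^-1 * (D * S) + D / n.
  by move: (D) (n) D0 n0 => D' n' D0 n0; field; lra.
rewrite E ler_norml; rewrite E' in up.
rewrite ler_pdivrMr // ler_pdivlMr //.
have nD0 : 0 <= n^-1 * D by rewrite mulr_ge0 ?invr_ge0 ?ltW.
rewrite mulNr [n^-1 * D]mulrC; rewrite [n^-1 * D]mulrC in nD0.
move: (n^-1 * (D * S)) (D / n) up dn nD0 => u w; lra.
Qed.

Lemma grid_sum_poly p : exists2 C : R, 0 <= C & forall m,
  `|(\sum_(i < m) p.[@grid R m i]) / m.+1%:R - (primitive p).[1]| <= C / m.+1%:R.
Proof.
exists (\sum_(j < size p) `|p`_j|); first exact: sumr_ge0.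
move=> m; rewrite primitive_at1.
have -> : (\sum_(i < m) p.[grid i]) / m.+1%:R - \sum_(j < size p) p`_j / j.+1%:R =
   \sum_(j < size p) p`_j * ((\sum_(i < m) @grid R m i ^+ j) / m.+1%:R - j.+1%:R^-1).
  under eq_bigr do rewrite horner_coef.
  rewrite exchange_big mulr_suml -sumrB; apply: eq_bigr => j _.
  by rewrite mulrBr mulrA mulr_sumr.
apply: (le_trans (ler_norm_sum _ _ _)); rewrite mulr_suml.
apply: ler_sum => j _; rewrite normrM ler_wpM2l //.
exact: grid_sum_monomial.
Qed.

End Primitive.

Section BernPoly.
Context {R : realFieldType} {I : finType}.
Definition expct_poly (F : {ffun I -> bool} -> R) : {poly R} :=
  \sum_x F x *: \prod_i (if x i then 'X else 1 - 'X).
Lemma horner_expct_poly (F : {ffun I -> bool} -> R) q :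
  (expct_poly F).[q] = expct q F.
Proof.
rewrite /expct_poly horner_sum; apply: eq_bigr => x _.
rewrite hornerZ mulrC horner_prod; congr (_ * _); apply: eq_bigr => i _.
by rewrite /bern; case: (x i); rewrite !hornerE.
Qed.
End BernPoly.

Lemma le_of_inv_nat (R : archiRealFieldType) (x y K : R) :
  (forall m, x <= y + K / m.+1%:R) -> x <= y.
Proof.
move=> h; rewrite leNgt; apply/negP => yx.
have K0 : 0 < K by have := h 0%N; rewrite divr1; lra.
have d0 : 0 < x - y by lra.
have := archi_boundP (ltW (divr_gt0 K0 d0)).
set N := Num.bound _ => hN; have := h N; apply/negP; rewrite -ltNge.
rewrite -ltrBrDl ltr_pdivrMr ?ltr0n // mulrC -ltr_pdivrMr //.
by apply: (lt_trans hN); rewrite ltr_nat.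
Qed.

(** * The lower bound for the integral *)

Section LowerBound.
Context {R : archiRealFieldType} {I : finType} (a : I -> R).
Definition absdot (x : {ffun I -> bool}) : R := `|\sum_j a j * (x j)%:R|.

(** The two arguments on the right are X and s - X, and g = X - (s - X). *)
Lemma signsum_le_absdot (x : {ffun I -> bool}) :
  `|signsum a x| <= absdot x + absdot (negx x).
Proof.
have -> : signsum a x = \sum_j a j * (x j)%:R - \sum_j a j * (negx x j)%:R.
  rewrite /signsum -sumrB; apply: eq_bigr => j _; rewrite ffunE /spin.
  by case: (x j) => /=; ring.
exact: ler_normB.
Qed.

Lemma wt_ge0 (q : R) (x : {ffun I -> bool}) : 0 <= q <= 1 -> 0 <= wt q x.
Proof. by move=> hq; apply: prodr_ge0 => i _; rewrite /bern; case: ifP => _; lra. Qed.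

(** Pairing q with 1 - q in the grid sum of E|X| bounds it below by half the
    grid sum of H; then n tends to infinity in [grid_inequality]. *)
Lemma primitive_absdot_ge : 2 / 9 * sqnorm a <=
  4 * (primitive (expct_poly absdot)).[1] ^+ 2 /\
  0 <= (primitive (expct_poly absdot)).[1].
Proof.
set v := (primitive _).[1].
have [C C0 hC] := grid_sum_poly (expct_poly absdot).
pose r m := (\sum_(i < m) (expct_poly absdot).[@grid R m i]) / m.+1%:R.
have u0 m (i : 'I_m) : 0 <= expct (@grid R m i) absdot.
  apply: sumr_ge0 => x _; rewrite mulr_ge0 ?normr_ge0 // wt_ge0 //.
  by have := @grid_itv R m i; lra.
have r0 m : 0 <= r m.
  rewrite divr_ge0 // sumr_ge0 // => i _; rewrite horner_expct_poly; exact: u0.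
have rv m : r m <= v + C / m.+1%:R.
  by have := hC m; rewrite ler_norml -/v -/(r m) => /andP[_]; rewrite lerBlDl.
have v0 : 0 <= v.
  apply: (@le_of_inv_nat _ _ _ C) => m; exact: le_trans (r0 m) (rv m).
split=> //.
have sq0 : 0 <= sqnorm a by apply: sumr_ge0 => j _; exact: sqr_ge0.
apply: (@le_of_inv_nat _ _ _ (4 * (2 * v * C + C ^+ 2) + 2 / 3 * sqnorm a)) => m.
have key : 4 * sqnorm a * (m.+1%:R / 3 - 1 / 2) * \sum_(i < m) bvar (@grid R m i) <=
    4 * (r m * m.+1%:R) ^+ 2.
  apply: (le_trans (grid_inequality a m)).
  have -> : 4 * (r m * m.+1%:R) ^+ 2 = (2 * (r m * m.+1%:R)) ^+ 2 by ring.
  rewrite lerXn2r ?nnegrE //.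
  - apply: sumr_ge0 => i _; apply: sumr_ge0 => x _; rewrite mulr_ge0 //.
    by rewrite wt_ge0 //; have := @grid_itv R m i; lra.
  - by rewrite mulr_ge0 // mulr_ge0.
  have -> : 2 * (r m * m.+1%:R) = \sum_(i < m) expct (@grid R m i) absdot +
      \sum_(i < m) expct (@grid R m (rev_ord i)) absdot.
    rewrite (sum_rev (fun i => expct (@grid R m i) absdot)) /r /=.
    rewrite divfK ?pnatr_eq0 //; under eq_bigr do rewrite horner_expct_poly; ring.
  rewrite -big_split.
  apply: ler_sum => i _ /=; rewrite grid_rev expct_negx -big_split.
  apply: ler_sum => x _ /=; rewrite -mulrDr ler_wpM2l ?signsum_le_absdot //.
  by rewrite wt_ge0 //; have := @grid_itv R m i; lra.
rewrite sum_bvar in key.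
have n1 : 1 <= m.+1%:R :> R by rewrite ler1n.
move: (rv m) (r0 m) key; move: (r m) (m.+1%:R) n1 => z n n1 zv z0 key.
(* With t = 1/n, the grid inequality divided by n^2 reads
   (2/3) |a|^2 (1/3 - t/2) (1 - t^2) <= 4 z^2. *)
pose t := n^-1.
have t0 : 0 < t by rewrite invr_gt0; lra.
have t1 : t <= 1 by rewrite invf_le1 //; lra.
have {}key : 2 / 3 * sqnorm a * ((1 / 3 - t / 2) * (1 - t ^+ 2)) <= 4 * z ^+ 2.
  have -> : 2 / 3 * sqnorm a * ((1 / 3 - t / 2) * (1 - t ^+ 2)) =
     4 * sqnorm a * (n / 3 - 1 / 2) * ((n ^+ 2 - 1) / (6 * n)) / n ^+ 2.
    by rewrite /t; field; lra.
  rewrite ler_pdivrMr ?exprn_gt0 //; lra.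
have zz : z ^+ 2 <= v ^+ 2 + (2 * v * C + C ^+ 2) * t.
  apply: (@le_trans _ _ ((v + C * t) ^+ 2)).
    by rewrite lerXn2r ?nnegrE // addr_ge0 // mulr_ge0 // ltW.
  have -> : (v + C * t) ^+ 2 = v ^+ 2 + 2 * v * C * t + C ^+ 2 * t * t by ring.
  have : C ^+ 2 * t * t <= C ^+ 2 * t by rewrite ler_piMr // mulr_ge0 ?sqr_ge0 // ltW.
  lra.
have poly : 1 / 3 - t <= (1 / 3 - t / 2) * (1 - t ^+ 2) by nra.
have c0 : 0 <= 2 / 3 * sqnorm a by lra.
have := ler_wpM2l c0 poly; rewrite -/t; lra.
Qed.
End LowerBound.

From mathcomp Require Import all_classical all_reals all_analysis.
From mathcomp Require Import measurable_realfun.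

Import numFieldNormedType.Exports.

Local Open Scope classical_set_scope.

(** * Expectations and integrals *)

Lemma integral_poly (R : realType) (p : {poly R}) :
  (\int[lebesgue_measure]_(q in `[0%R, 1%R]) (p.[q])%:E)%E =
  ((primitive p).[1])%:E.
Proof.
rewrite (@continuous_FTC2 _ (horner p) (horner (primitive p))) //.
- by rewrite primitive_at0 sube0.
- by apply: continuous_subspaceT; exact: continuous_horner.
- split.
  + by move=> x _; exact: derivable_horner.
  + by apply: cvg_at_right_filter; exact: continuous_horner.
  + by apply: cvg_at_left_filter; exact: continuous_horner.
- by move=> x _; rewrite -derivE deriv_primitive.
Qed.

Section Law.
Context (d : measure_display) (T : measurableType d) (R : realType) (P : probability T R).
Context (I : finType) (B : I -> {RV P >-> R}) (q : R).
Context (bernB : forall j, bernoulli_RV q (B j)).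
Context (indepB : independent_RVs B).

Let atom (x : {ffun I -> bool}) : set T :=
  \bigcap_(j in [set` [set: I]%SET]) B j @^-1` [set (x j)%:R].

Let measurable_atom x : measurable (atom x).
Proof.
apply: fin_bigcap_measurable => [|j _]; first exact: finite_finset.
by rewrite -[_ @^-1` _]setTI; exact: measurable_funP.
Qed.

Let prob_atom x : P (atom x) = (wt q x)%:E.
Proof.
rewrite /atom (indepB (A := fun j => [set (x j)%:R])) //.
rewrite /wt -prodEFin; apply: eq_big => [j|j _]; first by rewrite finset.inE.
by have [h1 h0] := bernB j; rewrite /bern; case: (x j) => /=; rewrite ?h1 ?h0.
Qed.

(** The events fixing all the bits are disjoint, their probabilities are given by
    independence and add up to 1, and G is constant on each. *)
Lemma expectation_cube (G : T -> R) (F : {ffun I -> bool} -> R) :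
  measurable_fun setT G -> (forall w, 0 <= G w) ->
  (forall (x : {ffun I -> bool}) w, (forall j, B j w = (x j)%:R) -> G w = F x) ->
  ('E_P[G])%E = (expct q F)%:E.
Proof.
move=> mG G0 GF; pose D := \big[setU/set0]_(x : {ffun I -> bool}) atom x.
have triv : trivIset [set` index_enum {ffun I -> bool}] atom.
  apply/trivIsetP => x y _ _ nxy; rewrite -subset0 => w [xw yw].
  apply: (negP nxy); apply/eqP/ffunP => j.
  have := xw j; have := yw j; rewrite /= finset.inE => /(_ isT) -> /(_ isT) /eqP.
  by rewrite eqr_nat; case: (x j); case: (y j).
have mD : measurable D by apply: bigsetU_measurable.
have PD : P D = 1%E.
  rewrite -[LHS]mul1e -integral_cst // ge0_integral_bigsetU //; last first.
    exact: index_enum_uniq.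
  transitivity (\sum_(x : {ffun I -> bool}) (wt q x)%:E)%E.
    by apply: eq_bigr => x _; rewrite integral_cst // mul1e; exact: prob_atom.
  by rewrite sumEFin sum_wt.
have PDC : P (~` D) = 0%E.
  by rewrite probability_setC // PD subee.
rewrite unlock.
rewrite (@ge0_negligible_integral _ _ _ P setT (~` D)) //; last 3 first.
- exact: measurableC.
- exact/measurable_EFinP.
- by move=> w _; rewrite lee_fin.
rewrite setTD setCK /D ge0_integral_bigsetU //; last 3 first.
- exact: index_enum_uniq.
- by apply/measurable_EFinP; exact: measurable_funTS.
- by move=> w _; rewrite lee_fin.
rewrite /expct -sumEFin; apply: eq_bigr => x _.
transitivity (\int[P]_(w in atom x) (F x)%:E)%E.
  apply: eq_integral => w; rewrite inE => xw; congr (_%:E); apply: GF => j.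
  by have := xw j; rewrite /= finset.inE; exact.
rewrite integral_cst //= ?EFinM muleC; congr (_ * _)%E.
exact: prob_atom.
Qed.

End Law.

Lemma expectation_absdot d (T : measurableType d) (R : realType)
  (P : probability T R) (k : nat) (B : 'I_k -> {RV P >-> R}) (q : R) (a : 'I_k -> R) :
  (forall j, bernoulli_RV q (B j)) -> independent_RVs B ->
  ('E_P[fun w => `|\sum_(j < k) a j * B j w|%R])%E = (expct q (absdot a))%:E.
Proof.
move=> bB iB; apply: (expectation_cube bB iB) => //.
  apply: measurableT_comp => //; apply: measurable_sum => j.
  by apply: measurable_funM.
move=> x w Bx; rewrite /absdot; congr (`|_|).
by apply: eq_bigr => j _; rewrite Bx.
Qed.

(** * The extremal vector and the conclusion *)

Section Extremal.
Context {R : realType}.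
Definition antipodal (j : 'I_2) : R := if j == ord0 then (Num.sqrt 2)^-1 else - (Num.sqrt 2)^-1.

Lemma expct_antipodal q :
  expct q (absdot antipodal) = Num.sqrt 2 * bvar q.
Proof.
have s0 : 0 < Num.sqrt 2 :> R by rewrite sqrtr_gt0.
(* For bits b and c, |b - c| = b (1 - c) + (1 - b) c. *)
have E : expct q (absdot antipodal) =
   (Num.sqrt 2)^-1 * (expct q (fun x : {ffun 'I_2 -> bool} =>
      \prod_i (if i == ord0 then (x i)%:R else 1 - (x i)%:R)) +
    expct q (fun x : {ffun 'I_2 -> bool} =>
      \prod_i (if i == ord0 then 1 - (x i)%:R else (x i)%:R))).
  rewrite -big_split mulr_sumr; apply: eq_bigr => x _ /=.
  rewrite -mulrDr mulrCA; congr (_ * _).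
  rewrite /absdot /antipodal !big_ord_recl !big_ord0 /= !addr0 !mulr1.
  have -> : (Num.sqrt 2)^-1 * (x ord0)%:R + - (Num.sqrt 2)^-1 * (x (lift ord0 ord0))%:R =
    (Num.sqrt 2)^-1 * ((x ord0)%:R - (x (lift ord0 ord0))%:R) :> R by ring.
  rewrite normrM ger0_norm ?invr_ge0 ?ltW //; congr (_ * _).
  by case: (x ord0); case: (x (lift ord0 ord0)) => /=;
    rewrite ?subrr ?subr0 ?sub0r ?normr0 ?normrN ?normr1; ring.
rewrite E (expct_prod q (fun i (b : bool) => if i == ord0 then b%:R else 1 - b%:R)).
rewrite (expct_prod q (fun i (b : bool) => if i == ord0 then 1 - b%:R else b%:R)).
rewrite !big_ord_recl !big_ord0 /= /bvar.
have {1}-> : (Num.sqrt 2)^-1 = Num.sqrt 2 / 2 :> R.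
  by rewrite -{3}[2](@sqr_sqrtr R 2) //; field; rewrite gt_eqF.
by field.
Qed.
End Extremal.

Theorem theorem14 (R : realType) (d : nat -> R -> measure_display)
    (T : forall (k : nat) (q : R), measurableType (d k q))
    (P : forall (k : nat) (q : R), probability (T k q) R)
    (B : forall (k : nat) (q : R), 'I_k -> {RV (P k q) >-> R})
    (bernB : forall (k : nat) (q : R), 0 <= q <= 1 ->
       forall j : 'I_k, bernoulli_RV q (B k q j))
    (indepB : forall (k : nat) (q : R), 0 <= q <= 1 ->
       independent_RVs (B k q)) :
  kappa_bar B = (Num.sqrt 2 / 6)%:E.
Proof.
have s0 : 0 < Num.sqrt 2 :> R by rewrite sqrtr_gt0.
have s2 : Num.sqrt 2 ^+ 2 = 2 :> R by rewrite sqr_sqrtr.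
have valueE k (a : 'rV[R]_k) (p : {poly R}) :
    (forall q, p.[q] = expct q (absdot (a 0))) ->
    (\int[lebesgue_measure]_(q in `[0%R, 1%R])
      'E_(P k q)[fun w => `|\sum_(j < k) a 0%R j * B k q j w|%R])%E =
    ((primitive p).[1])%:E.
  move=> pE; rewrite -integral_poly; apply: eq_integral => q.
  rewrite inE /= in_itv /= => q01; rewrite pE.
  exact: expectation_absdot (bernB k q q01) (indepB k q q01).
apply/eqP; rewrite eq_le; apply/andP; split.
  apply: ereal_inf_lbound; exists 2%N, (\row_j antipodal j); split=> //.
    rewrite /l2norm !big_ord_recl big_ord0 !mxE /antipodal /= sqrrN addr0.
    by rewrite exprVn s2 -[RHS]sqrtr1; congr Num.sqrt; field.
  rewrite (valueE _ _ (Num.sqrt 2 *: ('X - 'X^2))) => [|q].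
    rewrite primitive_at1.
    have -> : size (Num.sqrt 2 *: ('X - 'X^2) : {poly R}) = 3%N.
      rewrite size_scale ?gt_eqF // addrC size_polyDl ?size_polyN ?size_polyXn //.
      by rewrite size_polyX.
    rewrite !big_ord_recl big_ord0 /= !coefZ !coefB !coefX !coefXn /=.
    by rewrite /bump /=; congr (_%:E); field.
  have -> : (\row_j antipodal j) 0 = antipodal :> ('I_2 -> R).
    by apply/funext => j; rewrite mxE.
  rewrite expct_antipodal hornerZ hornerD hornerN hornerX hornerXn.
  by congr (_ * _); rewrite /bvar; ring.
apply/ereal_infP => _ [k [a [_ a1 ->]]].
rewrite (valueE _ _ (expct_poly (absdot (a 0)))); last first.
  by move=> q; exact: horner_expct_poly.
rewrite lee_fin.
have [low pos] := primitive_absdot_ge (a 0).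
have sq1 : sqnorm (a 0) = 1.
  have := congr1 (fun x => x ^+ 2) a1; rewrite /l2norm sqr_sqrtr ?expr1n //.
  by apply: sumr_ge0 => j _; exact: sqr_ge0.
rewrite sq1 in low.
rewrite -(@ler_pXn2r _ 2) ?nnegrE ?divr_ge0 ?(ltW s0) //.
by rewrite expr_div_n s2; lra.
Qed.
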